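(* There are $46$ symmetry classes of uniform oriented gaussoids for $n=4$. They are represented by the following $46$ sign vectors, where the $24$ signs are the values on the elements of $\mathcal{A}$ in the order $a_{12}, a_{12|3}, a_{12|4}, a_{12|34}, a_{13}, a_{13|2}, a_{13|4}, a_{13|24}, a_{14}, a_{14|2}, a_{14|3}, a_{14|23}, a_{23}, a_{23|1}, a_{23|4}, a_{23|14}, a_{24}, a_{24|1}, a_{24|3}, a_{24|13}, a_{34}, a_{34|1}, a_{34|2}, a_{34|12}$: 1: ++++++++++++++++++++++++ 2: ++++++++++++------------ 3: +++++++++++++-+---+----- 4: +++++++++++++++++++++++- 5: ++++++++++-++-++----++++ 6: ++++++++++--+-+----+++++ 7: +++++++++++++++-+-+-+-+- 8: +++++++++++++++++-+++--- 9: +++++++++++++++-+-+----- 10: +++++++++++++++++-+++-+- 11: ++++++++++-++-+++---++++ 12: +++++++++++++++---+----- 13: ++++++++++--+---++++++++ 14: ++++++++++--+-+-----++++ 15: +++++++++++-+---+++++-++ 16: ++++++++++--++--++++++++ 17: +++++++++++++-+-+-+-+--- 18: +++++++++++++-+-+-+-+-+- 19: +++++++++++++++--------- 20: ++++++++++-++-+-+---++++ 21: +++++++++++++++++-+----- 22: +++++++++++-+---++++++++ 23: +++++++++++++++++-++---- 24: ++++++++++-++-+-+---+++- 25: +++++++++++-+-+-+++++-++ 26: +++++++++++++++++-+-+-+- 27: ++++++++++--+-+-++-+++++ 28: +++++++++++-+++-++++++++ 29: +++++++++++++++++++++--- 30: ++++++++++-+--+-----+++- 31: ++++++++++++++++++++----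 32: ++++++++++++++---------- 33: ++++++++++--+-+-+---++++ 34: +++++++++---+---++++++++ 35: +++++++++++++-+-+-+----- 36: ++++++++++++++--+-+-+-+- 37: +++++++++++++----------- 38: +++++++++++++++++-+-+--- 39: +++++++-++-++-+++---++++ 40: ++++++++++--+---+-++++++ 41: +++++++++++-++--++++++++ 42: ++++++++++++++++++++++-- 43: ++++++++++--+-+-+--+++++ 44: +++++++++++++++-+-+-+--- 45: ++++++++++-++-+-----++++ 46: ++++++++++-++-+-----+++- All but one of these classes (number 36) are realizable. The unique non-realizable class admits a bi-quadratic final polynomial.
   Context: Let $n=4$, $[n]=\{1,\dots,n\}$. $\mathcal{P}=\{p_I: I\subseteq[n]\}$ and $\mathcal{A}=\{a_{ij|K}: i,j\in[n]\text{ distinct},\,K\subseteq[n]\setminus\{i,j\}\}$ are sets of unknowns with $a_{ij|K}=a_{ji|K}$. Write $ijL$ for $\{i,j\}\cup L$, etc. The edge trinomials are the following polynomials, for all pairwise distinct $i,j,k\in[n]$ and $L\subseteq[n]\setminus\{i,j,k\}$: $p_{iL}\,a_{jk|L}-p_L\,a_{jk|iL}-a_{ij|L}\,a_{ik|L}$; $p_{ijL}\,a_{ik|L}-p_{iL}\,a_{ik|jL}-a_{ij|L}\,a_{jk|iL}$; $p_{ijkL}\,a_{ij|L}-p_{ijL}\,a_{ij|kL}-a_{ik|jL}\,a_{jk|iL}$. A uniform oriented gaussoid is a map $\phi:\mathcal{A}\to\{\pm1\}$ such that for each edge trinomial, after setting all elements of $\mathcal{P}$ to $+1$ and all elements of $\mathcal{A}$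 to their images, the set of values of the three signed terms is $\{-1,+1\}$. For $L\subseteq[n]$ the reorientation of $\phi$ along $L$ is $\phi_L(a_{ij|K})=(-1)^{|\{i,j\}\cap L|}\phi(a_{ij|K})$. Symmetry classes are orbits under the group generated by all reorientations and by the permutations of the indices $1,\dots,n$. $\phi$ is realizable if there is a real positive definite symmetric $n\times n$-matrix $\Sigma$ such that for all $a_{ij|K}\in\mathcal{A}$ the sign of the almost-principal minor $a_{ij|K}$ of $\Sigma$ (rows $i$ followed by $K$, columns $j$ followed by $K$, elements of $K$ in increasing order) equals $\phi(a_{ij|K})$. Realizability is constant on symmetry classes. Bi-quadratic final polynomial (Bokowski–Richter): given $\phi$, each edge trinomial can be written, up to a global sign, as $x_1x_2+x_3x_4-x_5x_6=0$, where each $x_i$ is either some $p_I$ or some $a_{ij|K}$ multiplied by its sign $\phi(a_{ij|K})$, so that all $x_i$ are positive in any realization. This implies $x_1x_2<x_5x_6$ and $x_3x_4<x_5x_6$, and hence, with $y_i=\log x_i$, the strict linear inequalities $y_1+y_2<y_5+y_6$ and $y_3+y_4<y_5+y_6$. If the system of all these linear inequalities, taken over all edge trinomials, has no real solution, then $\phi$ is non-realizable. A solution of the dual linear program certifying this infeasibility is called a bi-quadratic final polynomial for $\phi$. *)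

(* Defs.v *)
From Stdlib Require Import Ascii String.
From HB Require Import structures.
From mathcomp Require Import all_boot all_order all_algebra all_fingroup.
From mathcomp Require Import reals.

Set Implicit Arguments.
Unset Strict Implicit.
Unset Printing Implicit Defensive.

Import Order.TTheory GRing.Theory Num.Theory.
Local Open Scope ring_scope.

(* The ground set [n] = {1,...,n} is 'I_n, so the element k is the ordinal
   with value k-1.  Signs are booleans: b stands for (-1) ^+ b, so false is +1,
   true is -1, and products of signs are exclusive ors. *)

(* a_{ij|K} = a_{ji|K} is represented by the pair ({i,j}, K). *)
Definition is_aidx n (x : {set 'I_n} * {set 'I_n}) : bool :=
  (#|x.1| == 2)%N && [disjoint x.1 & x.2].

Definition aidx n := {x : {set 'I_n} * {set 'I_n} | is_aidx x}.

Definition unknown n := ({set 'I_n} + aidx n)%type.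

Definition pvar n (I : {set 'I_n}) : unknown n := inl I.

(* The value p_set0 outside of the intended domain (i, j distinct and not in K)
   is never used. *)
Definition avar n (i j : 'I_n) (K : {set 'I_n}) : unknown n :=
  if insub ([set i; j], K) is Some x then inr x else pvar set0.

(* A quadratic monomial, and a monomial with a coefficient +1 or -1. *)
Definition monomial n := (unknown n * unknown n)%type.
Definition term n := (bool * monomial n)%type.
Definition trinomial n := 3.-tuple (term n).

Definition trinomials_at n (i j k : 'I_n) (L : {set 'I_n}) :
    seq (trinomial n) :=
  [:: [tuple (false, (pvar (i |: L), avar j k L));
             (true,  (pvar L, avar j k (i |: L)));
             (true,  (avar i j L, avar i k L))];
      [tuple (false, (pvar (i |: (j |: L)), avar i k L));
             (true,  (pvar (i |: L), avar i k (j |: L)));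
             (true,  (avar i j L, avar j k (i |: L)))];
      [tuple (false, (pvar (i |: (j |: (k |: L))), avar i j L));
             (true,  (pvar (i |: (j |: L)), avar i j (k |: L)));
             (true,  (avar i k (j |: L), avar j k (i |: L)))]].

Definition edge_trinomials n : {set trinomial n} :=
  [set T | [exists i : 'I_n, exists j : 'I_n, exists k : 'I_n,
            exists L : {set 'I_n},
     [&& uniq [:: i; j; k], [disjoint [set i; j; k] & L]
       & T \in trinomials_at i j k L]]].

Definition sign_map n := {ffun aidx n -> bool}.

Definition unknown_sign n (phi : sign_map n) (u : unknown n) : bool :=
  if u is inr x then phi x else false.

Definition term_sign n (phi : sign_map n) (t : term n) : bool :=
  t.1 (+) unknown_sign phi t.2.1 (+) unknown_sign phi t.2.2.

Definition uniform_oriented_gaussoid n (phi : sign_map n) : bool :=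
  [forall T in edge_trinomials n,
     [set term_sign phi t | t in T] == [set false; true]].

Definition reorient n (L : {set 'I_n}) (phi : sign_map n) : sign_map n :=
  [ffun x => odd #|(val x).1 :&: L| (+) phi x].

Lemma reorient_inj n (L : {set 'I_n}) : injective (reorient L).
Proof.
move=> f g /ffunP fg; apply/ffunP => x.
by have := fg x; rewrite !ffunE => /addbI.
Qed.

Lemma is_aidx_perm n (s : 'S_n) (x : aidx n) :
  is_aidx (s @: (val x).1, s @: (val x).2).
Proof.
rewrite /is_aidx /= card_imset; last exact: perm_inj.
rewrite -!setI_eq0 -imsetI; last by move=> ? ? _ _; apply: perm_inj.
by rewrite imset_eq0 setI_eq0; exact: (valP x).
Qed.

Definition aidx_perm n (s : 'S_n) (x : aidx n) : aidx n :=
  Sub (s @: (val x).1, s @: (val x).2) (is_aidx_perm s x).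

Lemma aidx_permKV n (s : 'S_n) : cancel (aidx_perm s^-1%g) (aidx_perm s).
Proof.
move=> x; apply: val_inj => /=; rewrite -!imset_comp.
have e (A : {set 'I_n}) : [set (s \o s^-1%g) y | y in A] = A.
  by rewrite -[RHS]imset_id; apply: eq_imset => y /=; rewrite permKV.
by rewrite !e; case: (val x).
Qed.

Definition relabel n (s : 'S_n) (phi : sign_map n) : sign_map n :=
  [ffun x => phi (aidx_perm s x)].

Lemma relabel_inj n (s : 'S_n) : injective (relabel s).
Proof.
move=> f g /ffunP fg; apply/ffunP => x.
by have := fg (aidx_perm s^-1%g x); rewrite !ffunE aidx_permKV.
Qed.

Definition symmetry_group n : {group {perm sign_map n}} :=
  <<[set perm (@reorient_inj n L) | L : {set 'I_n}]
    :|: [set perm (@relabel_inj n s) | s : 'S_n]>>%G.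

Definition symmetry_class n (phi : sign_map n) : {set sign_map n} :=
  orbit 'P (symmetry_group n) phi.

Definition gaussoid_classes n : {set {set sign_map n}} :=
  [set symmetry_class phi | phi : sign_map n & uniform_oriented_gaussoid phi].

Section Realizability.
Variable R : realType.

Definition positive_definite n (S : 'M[R]_n) : Prop :=
  S^T = S /\ forall u : 'rV[R]_n, u != 0 -> 0 < (u *m S *m u^T) 0 0.

(* enum K lists the elements of K in increasing order. *)
Definition almost_principal_minor n (S : 'M[R]_n) (i j : 'I_n)
    (K : {set 'I_n}) : R :=
  \det (\matrix_(r < #|K|.+1, c < #|K|.+1)
          S (nth i (i :: enum K) r) (nth j (j :: enum K) c)).

Definition realizable n (phi : sign_map n) : Prop :=
  exists2 S : 'M[R]_n, positive_definite S &
    forall (i j : 'I_n) (K : {set 'I_n}),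
      i != j -> i \notin K -> j \notin K ->
      Num.sg (almost_principal_minor S i j K)
        = (-1) ^+ unknown_sign phi (avar i j K).

(* A pair (m, m') in this set encodes the inequality
   y_{m.1} + y_{m.2} < y_{m'.1} + y_{m'.2}, where m' is the monomial of the
   term whose sign under phi is opposite to that of the two other terms of
   its trinomial, and m is the monomial of one of these two. *)
Definition biquadratic_inequalities n (phi : sign_map n) :
    {set monomial n * monomial n} :=
  [set e | [exists T in edge_trinomials n, exists r : 'I_3, exists s : 'I_3,
     [&& [forall s' : 'I_3, (s' != r) ==>
            (term_sign phi (tnth T s') != term_sign phi (tnth T r))],
         s != r & e == ((tnth T s).2, (tnth T r).2)]]].

Definition multiplicity n (u : unknown n) (m : monomial n) : R :=
  ((u == m.1) + (u == m.2))%N%:R.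

Definition biquadratic_solution n (phi : sign_map n) (y : unknown n -> R) :
    Prop :=
  forall e, e \in biquadratic_inequalities phi ->
    y e.1.1 + y e.1.2 < y e.2.1 + y e.2.2.

(* By Gordan's alternative, the homogeneous strict system has no solution iff
   nonnegative multipliers, not all zero, combine its inequalities to 0 < 0. *)
Definition biquadratic_final_polynomial n (phi : sign_map n)
    (w : monomial n * monomial n -> R) : Prop :=
  [/\ forall e, e \in biquadratic_inequalities phi -> 0 <= w e,
      exists2 e, e \in biquadratic_inequalities phi & 0 < w e
    & forall u : unknown n,
        \sum_(e in biquadratic_inequalities phi)
          w e * (multiplicity u e.2 - multiplicity u e.1) = 0].

Lemma sum_multiplicity n (y : unknown n -> R) (m : monomial n) :
  \sum_u multiplicity u m * y u = y m.1 + y m.2.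
Proof.
have e v : \sum_u (u == v)%:R * y u = y v.
  rewrite (bigD1 v) //= eqxx mul1r big1 ?addr0 // => u /negbTE ->.
  by rewrite mul0r.
rewrite -(e m.1) -(e m.2) -big_split /=; apply: eq_bigr => u _.
by rewrite /multiplicity natrD mulrDl.
Qed.

Lemma biquadratic_final_polynomial_infeasible n (phi : sign_map n) w y :
  biquadratic_final_polynomial phi w -> ~ biquadratic_solution phi y.
Proof.
case=> w0 [e0 e0P w0gt] wE yP.
set I := biquadratic_inequalities phi in w0 e0P wE.
have: \sum_(e in I) w e * ((y e.2.1 + y e.2.2) - (y e.1.1 + y e.1.2)) = 0.
  under eq_bigr => e _ do
    rewrite -!sum_multiplicity -sumrB mulr_sumr.
  rewrite exchange_big /= big1 // => u _.
  under eq_bigr => e _ do rewrite -mulrBl mulrA.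
  by rewrite -mulr_suml wE mul0r.
apply/eqP; rewrite (bigD1 e0) //= gt_eqF //; apply: ltr_pwDl.
  by rewrite mulr_gt0 // subr_gt0; apply: yP.
apply: sumr_ge0 => e /andP[eP _]; rewrite mulr_ge0 ?w0 //.
by rewrite subr_ge0 ltW //; apply: yP.
Qed.

End Realizability.

(* Here labels of elements of [4] are 1-based: (i, j, K) is a_{ij|K}. *)
Definition sign_order : seq (nat * nat * seq nat) :=
  [:: (1, 2, [::]); (1, 2, [:: 3]); (1, 2, [:: 4]); (1, 2, [:: 3; 4]);
      (1, 3, [::]); (1, 3, [:: 2]); (1, 3, [:: 4]); (1, 3, [:: 2; 4]);
      (1, 4, [::]); (1, 4, [:: 2]); (1, 4, [:: 3]); (1, 4, [:: 2; 3]);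
      (2, 3, [::]); (2, 3, [:: 1]); (2, 3, [:: 4]); (2, 3, [:: 1; 4]);
      (2, 4, [::]); (2, 4, [:: 1]); (2, 4, [:: 3]); (2, 4, [:: 1; 3]);
      (3, 4, [::]); (3, 4, [:: 1]); (3, 4, [:: 2]); (3, 4, [:: 1; 2])]%N.

Definition element (k : nat) : 'I_4 := inord k.-1.

Definition label_sets (l : nat * nat * seq nat) : {set 'I_4} * {set 'I_4} :=
  let: (i, j, K) := l in
  ([set element i; element j], [set x in map element K]).

Definition sign_map_of (v : string) : sign_map 4 :=
  [ffun x => nth false [seq Ascii.eqb c "-"%char | c <- list_ascii_of_string v]
                       (index (val x) (map label_sets sign_order))].

Definition sign_vectors : seq string := [::
  "++++++++++++++++++++++++";
  "++++++++++++------------";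
  "+++++++++++++-+---+-----";
  "+++++++++++++++++++++++-";
  "++++++++++-++-++----++++";
  "++++++++++--+-+----+++++";
  "+++++++++++++++-+-+-+-+-";
  "+++++++++++++++++-+++---";
  "+++++++++++++++-+-+-----";
  "+++++++++++++++++-+++-+-";
  "++++++++++-++-+++---++++";
  "+++++++++++++++---+-----";
  "++++++++++--+---++++++++";
  "++++++++++--+-+-----++++";
  "+++++++++++-+---+++++-++";
  "++++++++++--++--++++++++";
  "+++++++++++++-+-+-+-+---";
  "+++++++++++++-+-+-+-+-+-";
  "+++++++++++++++---------";
  "++++++++++-++-+-+---++++";
  "+++++++++++++++++-+-----";
  "+++++++++++-+---++++++++";
  "+++++++++++++++++-++----";
  "++++++++++-++-+-+---+++-";
  "+++++++++++-+-+-+++++-++";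
  "+++++++++++++++++-+-+-+-";
  "++++++++++--+-+-++-+++++";
  "+++++++++++-+++-++++++++";
  "+++++++++++++++++++++---";
  "++++++++++-+--+-----+++-";
  "++++++++++++++++++++----";
  "++++++++++++++----------";
  "++++++++++--+-+-+---++++";
  "+++++++++---+---++++++++";
  "+++++++++++++-+-+-+-----";
  "++++++++++++++--+-+-+-+-";
  "+++++++++++++-----------";
  "+++++++++++++++++-+-+---";
  "+++++++-++-++-+++---++++";
  "++++++++++--+---+-++++++";
  "+++++++++++-++--++++++++";
  "++++++++++++++++++++++--";
  "++++++++++--+-+-+--+++++";
  "+++++++++++++++-+-+-+---";
  "++++++++++-++-+-----++++";
  "++++++++++-++-+-----+++-"]%string.

Definition representatives : seq (sign_map 4) := map sign_map_of sign_vectors.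

(* The representatives are numbered from 1. *)
Definition representative (k : nat) : sign_map 4 :=
  nth [ffun=> false] representatives k.-1.

(* Main.v *)
From Stdlib Require Import Ascii String ZArith.
Require Import Defs.
From HB Require Import structures.
From mathcomp Require Import all_boot all_order all_algebra all_fingroup.
From mathcomp Require Import reals.
From mathcomp Require Import ssrZ ring.

(** Two finite facts and a little linear algebra prove the classification.

    Symmetries.  A relabelling conjugates reorientations into reorientations,
    so the symmetry class of phi consists of the maps obtained from phi by one
    relabelling followed by one reorientation ([symmetry_classP]), and each of
    the properties in question (axioms, realizability, existence of a final
    polynomial) passes from phi to its whole class.

    Counting.  A sign map on [4] is its vector of 24 signs ([code]).  Order
    these vectors lexicographically with + before -.  Every class has exactly
    one least vector, and the 46 listed vectors are the least vectors of the
    classes of gaussoids.  To see this, sign vectors are built entry by entry;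
    a prefix is dropped as soon as it violates an edge trinomial or can be
    made smaller by a reorientation.  Reorientations only flip entries, so a
    least vector has only prefixes that survive
    ([gaussoid_prefixes_complete]).  672 vectors of length 24 survive, and
    keeping those that no symmetry makes smaller leaves the 46
    ([least_gaussoid_codes]).  Two least vectors in one class are equal, hence
    the 46 classes are distinct.

    Realizable classes.  Each representative other than the 36th is realized
    by L L^T for an explicit lower triangular integer matrix L with nonzero
    diagonal; the signs of its almost-principal minors are a computation with
    determinants of size at most three ([factors_realize],
    [realizable_factor]).

    The class of the 36th representative.  There all a_{ij} are positive,
    a_{34|1} and a_{23|4} are negative, a_{12|4} and a_{23|1} are positive.
    The trinomials p_i a_{jk} - a_{jk|i} - a_{ij} a_{ik} (with p_{} = 1) give
<<
      p_1 a_34 < a_13 a_14,      a_14 a_24 < p_4 a_12,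
      p_4 a_23 < a_24 a_34,      a_12 a_13 < p_1 a_23.
>>
    The products of the four left and of the four right hand sides are the
    same monomial.  Hence the four inequalities with weight one are a
    bi-quadratic final polynomial ([representative36_final_polynomial]), and
    multiplying them contradicts realizability
    ([representative36_not_realizable]). *)

Set Implicit Arguments.
Unset Strict Implicit.
Unset Printing Implicit Defensive.
Import Order.TTheory GRing.Theory Num.Theory.
Local Open Scope ring_scope.

(** * Symmetries of sign maps *)

Section Symmetry.
Variable n : nat.
Implicit Types (phi psi : sign_map n) (L K : {set 'I_n}) (s : 'S_n).

Lemma odd_card_setI2 (i j : 'I_n) L :
  i != j -> odd #|[set i; j] :&: L| = (i \in L) (+) (j \in L).
Proof.
move=> ij; rewrite setIUl cardsU setIACA setIid.
have -> : [set i] :&: [set j] = set0.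
  by apply/setP => x; rewrite !inE; case: eqP => // ->; rewrite (negbTE ij).
have c1 (k : 'I_n) : #|[set k] :&: L| = (k \in L).
  case: (boolP (k \in L)) => kL; first by rewrite (setIidPl _) ?cards1 ?sub1set.
  by apply/eqP; rewrite cards_eq0 setI_eq0 disjoints1.
by rewrite set0I cards0 subn0 !c1 oddD !oddb.
Qed.

(** [avar] hides a default value behind [insub]; on proper arguments the genuine
    index is exhibited, so that [avar] can be rewritten away. *)
Lemma insub_aidxP (i j : 'I_n) K : i != j -> i \notin K -> j \notin K ->
  {x : aidx n | val x = ([set i; j], K) & avar i j K = inr x}.
Proof.
move=> ij iK jK; rewrite /avar.
have P : is_aidx ([set i; j], K).
  rewrite /is_aidx /= cards2 ij /= disjoint_subset; apply/subsetP => x.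
  by rewrite !inE => /orP[]/eqP->.
by case: insubP => [x _ <-|]; [exists x | rewrite P].
Qed.

Lemma aidx_cases (x : aidx n) : exists i j K,
  [/\ i != j, i \notin K, j \notin K, val x = ([set i; j], K)
    & avar i j K = inr x].
Proof.
have /andP[/cards2P[i [j [ij e]]] dj] := valP x.
move: dj; rewrite e disjoint_sym disjoint_subset => /subsetP dj.
have iK : i \notin (val x).2 by apply/negP => /dj; rewrite !inE eqxx.
have jK : j \notin (val x).2 by apply/negP => /dj; rewrite !inE eqxx orbT.
exists i, j, (val x).2; split=> //; first by rewrite -e; case: (val x).
have [y vy ->] := insub_aidxP ij iK jK; congr inr; apply: val_inj.
by rewrite vy -e; case: (val x).
Qed.

Lemma avarC (i j : 'I_n) K : avar i j K = avar j i K.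
Proof. by rewrite /avar setUC. Qed.

Lemma unknown_sign_reorient L phi (i j : 'I_n) K :
  i != j -> i \notin K -> j \notin K ->
  unknown_sign (reorient L phi) (avar i j K)
    = (i \in L) (+) (j \in L) (+) unknown_sign phi (avar i j K).
Proof.
move=> ij iK jK; have [x vx ->] := insub_aidxP ij iK jK.
by rewrite /= ffunE vx odd_card_setI2.
Qed.

Definition unknown_perm s (u : unknown n) : unknown n :=
  match u with
  | inl A => inl (s @: A)
  | inr x => inr (aidx_perm s x)
  end.

Lemma unknown_permK s : cancel (unknown_perm s) (unknown_perm s^-1%g).
Proof.
case=> [A|x] /=; last by congr inr; rewrite -{2}[s]invgK aidx_permKV.
congr inl; rewrite -imset_comp -[RHS]imset_id; apply: eq_imset => y /=.
by rewrite permK.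
Qed.

Lemma unknown_perm_avar s (i j : 'I_n) K :
  i != j -> i \notin K -> j \notin K ->
  unknown_perm s (avar i j K) = avar (s i) (s j) (s @: K).
Proof.
move=> ij iK jK; have [x vx ->] := insub_aidxP ij iK jK.
have [|||y vy ->] := @insub_aidxP (s i) (s j) (s @: K).
- by rewrite (inj_eq perm_inj).
- by rewrite mem_imset //; apply: perm_inj.
- by rewrite mem_imset //; apply: perm_inj.
congr inr; apply: val_inj; rewrite vy /= vx /=.
by rewrite imsetU1 imset_set1.
Qed.

Lemma unknown_sign_relabel s phi u :
  unknown_sign (relabel s phi) u = unknown_sign phi (unknown_perm s u).
Proof. by case: u => //= x; rewrite ffunE. Qed.

Lemma aidx_permM s (t : 'S_n) x : aidx_perm t (aidx_perm s x) = aidx_perm (s * t)%g x.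
Proof.
apply: val_inj => /=; rewrite -!imset_comp.
by congr pair; apply: eq_imset => y /=; rewrite permM.
Qed.

Lemma relabel_comp s (t : 'S_n) phi :
  relabel s (relabel t phi) = relabel (s * t)%g phi.
Proof. by apply/ffunP => x; rewrite !ffunE aidx_permM. Qed.

Lemma relabel1 phi : relabel 1%g phi = phi.
Proof.
apply/ffunP => x; rewrite ffunE; congr (phi _); apply: val_inj => /=.
have e (A : {set 'I_n}) : [set (1%g : 'S_n) y | y in A] = A.
  by rewrite -[RHS]imset_id; apply: eq_imset => y; rewrite perm1.
by rewrite !e; case: (val x).
Qed.

Lemma reorient0 phi : reorient set0 phi = phi.
Proof. by apply/ffunP => x; rewrite ffunE setI0 cards0. Qed.

Lemma reorient_comp L M phi :
  reorient L (reorient M phi) = reorient ((L :\: M) :|: (M :\: L)) phi.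
Proof.
apply/ffunP => x; have [i [j [K [ij _ _ vx _]]]] := aidx_cases x.
rewrite !ffunE vx /= !odd_card_setI2 // !inE addbA; congr (_ (+) _).
by case: (i \in L) (i \in M) (j \in L) (j \in M) => [] [] [] [].
Qed.

Lemma relabel_reorient s L phi :
  relabel s (reorient L phi) = reorient (s @^-1: L) (relabel s phi).
Proof.
apply/ffunP => x; have [i [j [K [ij _ _ vx _]]]] := aidx_cases x.
rewrite !ffunE /= vx /= imsetU1 imset_set1.
by rewrite !odd_card_setI2 ?inE // (inj_eq perm_inj).
Qed.

(** Conjugating a reorientation by a relabelling gives a reorientation, so
    every product of generators collapses to one of each kind. *)
Lemma symmetry_classP phi psi :
  reflect (exists L s, psi = reorient L (relabel s phi))
          (psi \in symmetry_class phi).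
Proof.
apply: (iffP idP); last first.
  case=> L [s ->]; rewrite /symmetry_class.
  apply/orbitP; exists (perm (@relabel_inj n s) * perm (@reorient_inj n L))%g.
    by apply: groupM; apply: mem_gen; rewrite !inE; apply/orP;
       [right | left]; apply: imset_f.
  by rewrite /= apermE permM !permE.
(* It suffices that this set is stable under the generators. *)
pose C := [set psi | [exists L, exists s, psi == reorient L (relabel s phi)]].
have CP psi' : reflect (exists L s, psi' = reorient L (relabel s phi))
    (psi' \in C).
  rewrite inE; apply: (iffP existsP) => [[L /existsP[s /eqP->]]|[L [s ->]]].
    by exists L, s.
  by exists L; apply/existsP; exists s.
have acts_C : [acts symmetry_group n, on C | 'P].
  rewrite gen_subG; apply/subsetP => g g_gen.
  rewrite !inE /=; apply/subsetP => _ /CP[M [t ->]].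
  rewrite inE /= apermE; apply/CP.
  case/setUP: g_gen => /imsetP[u _ ->]; rewrite permE.
    by rewrite reorient_comp; eexists; eexists.
  by rewrite relabel_reorient relabel_comp; eexists; eexists.
have phiC : phi \in C.
  by apply/CP; exists set0, 1%g; rewrite relabel1 reorient0.
move=> /(subsetP (_ : symmetry_class phi \subset C)) psiC.
by apply/CP/psiC; rewrite acts_sub_orbit.
Qed.

Lemma symmetry_class_sym phi psi :
  (psi \in symmetry_class phi) = (phi \in symmetry_class psi).
Proof. exact: orbit_sym. Qed.

(** * Invariance of the axioms and of the final polynomials *)

Lemma edge_trinomialsP (T : trinomial n) :
  reflect (exists i j k L, [/\ uniq [:: i; j; k],
             [/\ i \notin L, j \notin L & k \notin L]
           & T \in trinomials_at i j k L])
          (T \in edge_trinomials n).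
Proof.
have dP (i j k : 'I_n) L :
    reflect [/\ i \notin L, j \notin L & k \notin L] [disjoint [set i; j; k] & L].
  rewrite disjoint_subset; apply: (iffP subsetP) => [dL|[iL jL kL] x].
    by split; apply: dL; rewrite !inE eqxx ?orbT.
  by rewrite !inE => /orP[/orP[]|] /eqP->.
rewrite inE; apply: (iffP existsP).
  case=> i /existsP[j /existsP[k /existsP[L /and3P[u /dP d TP]]]].
  by exists i, j, k, L.
case=> i [j [k [L [u d TP]]]]; exists i; apply/existsP; exists j.
apply/existsP; exists k; apply/existsP; exists L.
by rewrite u TP (introT (dP i j k L) d).
Qed.

Definition term_perm s (t : term n) : term n :=
  (t.1, (unknown_perm s t.2.1, unknown_perm s t.2.2)).

Lemma term_sign_relabel s phi t :
  term_sign (relabel s phi) t = term_sign phi (term_perm s t).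
Proof. by rewrite /term_sign !unknown_sign_relabel. Qed.

(** Permuting i, j, k, L permutes the edge trinomials, term by term and without
    changing signs. *)
Lemma edge_trinomials_perm s T :
  T \in edge_trinomials n -> map_tuple (term_perm s) T \in edge_trinomials n.
Proof.
case/edge_trinomialsP => i [j [k [L [uq [iL jL kL] TP]]]].
have [ij ik jk] : [/\ i != j, i != k & j != k].
  by move: uq; rewrite /= !inE negb_or andbT => /andP[/andP[-> ->] ->].
have inS (x : 'I_n) (A : {set 'I_n}) : (s x \in s @: A) = (x \in A).
  by rewrite mem_imset //; apply: perm_inj.
apply/edge_trinomialsP; exists (s i), (s j), (s k), (s @: L).
rewrite !inS; split=> //; first by rewrite -(map_inj_uniq (@perm_inj _ s)) in uq.
have U1 (x : 'I_n) (A : {set 'I_n}) : s x |: s @: A = s @: (x |: A).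
  by rewrite imsetU1.
rewrite /trinomials_at !U1; move: TP; rewrite !inE.
have av := unknown_perm_avar s.
by case/or3P => /eqP->; apply/or3P;
  [apply: Or31|apply: Or32|apply: Or33]; apply/eqP/val_inj;
  rewrite /= /term_perm /= !av ?inE ?negb_or ?iL ?jL ?kL ?ij ?ik ?jk //
    eq_sym ?ij ?ik ?jk.
Qed.

(** Reorientation multiplies the three terms of an edge trinomial by one
    common sign, since the indices occur with the same parity in each of
    them. *)
Lemma term_sign_reorient M phi T :
  T \in edge_trinomials n ->
  exists c, forall r,
    term_sign (reorient M phi) (tnth T r) = c (+) term_sign phi (tnth T r).
Proof.
case/edge_trinomialsP => i [j [k [L [uq [iL jL kL] TP]]]].
have [ij ik jk] : [/\ i != j, i != k & j != k].
  by move: uq; rewrite /= !inE negb_or andbT => /andP[/andP[-> ->] ->].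
have [ji ki kj] : [/\ j != i, k != i & k != j] by split; rewrite eq_sym.
have us := unknown_sign_reorient M phi.
pose t0 : term n := (false, (pvar set0, pvar set0)).
move: TP; rewrite !inE => /or3P[]/eqP->;
  [exists ((j \in M) (+) (k \in M)) | exists ((i \in M) (+) (k \in M))
   | exists ((i \in M) (+) (j \in M))];
  case=> [[|[|[|//]]] lt3]; rewrite !(tnth_nth t0) /= /term_sign /=;
  rewrite !us ?inE ?negb_or ?iL ?jL ?kL ?ij ?ik ?jk ?ji ?ki ?kj //;
  case: (i \in M) (j \in M) (k \in M) => [] [] [] //=;
  by do 2?case: (unknown_sign _ (avar _ _ _)).
Qed.

(** A comparison of two terms is visibly unaffected by a common sign change and
    by a renaming of the unknowns, unlike the set of signs. *)
Lemma both_signsE (f : term n -> bool) (T : trinomial n) :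
  ([set f t | t in T] == [set false; true])
    = [exists r, exists r', f (tnth T r) != f (tnth T r')].
Proof.
apply/eqP/existsP => [fT|[r /existsP[r' ne]]].
  have /imsetP[x /tnthP[r ->] fr] : false \in [set f t | t in T].
    by rewrite fT !inE.
  have /imsetP[y /tnthP[r' ->] fr'] : true \in [set f t | t in T].
    by rewrite fT !inE.
  by exists r; apply/existsP; exists r'; rewrite -fr -fr'.
apply/setP => b; rewrite [RHS](_ : _ = true); last by rewrite !inE; case: b.
have [->|->] : b = f (tnth T r) \/ b = f (tnth T r').
- by move: ne; case: b; case: (f (tnth T r)); case: (f (tnth T r')) => // _;
     by [left | right].
- by apply: imset_f; apply: mem_tnth.
- by apply: imset_f; apply: mem_tnth.
Qed.

Lemma gaussoid_reorient L phi :
  uniform_oriented_gaussoid phi -> uniform_oriented_gaussoid (reorient L phi).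
Proof.
move/forall_inP => gphi; apply/forall_inP => T TP.
have := gphi T TP; rewrite !both_signsE.
have [c cE] := term_sign_reorient L phi TP.
case/existsP => r /existsP[r' ne]; apply/existsP; exists r.
by apply/existsP; exists r'; rewrite !cE (inj_eq (can_inj (addKb c))).
Qed.

Lemma gaussoid_relabel s phi :
  uniform_oriented_gaussoid phi -> uniform_oriented_gaussoid (relabel s phi).
Proof.
move/forall_inP => gphi; apply/forall_inP => T TP.
have := gphi _ (edge_trinomials_perm s TP); rewrite !both_signsE.
case/existsP => r /existsP[r' ne]; apply/existsP; exists r.
by apply/existsP; exists r'; rewrite !term_sign_relabel -!(tnth_map (term_perm s)).
Qed.

Lemma gaussoid_symmetry phi psi : psi \in symmetry_class phi ->
  uniform_oriented_gaussoid phi -> uniform_oriented_gaussoid psi.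
Proof.
by case/symmetry_classP => L [s ->] g; apply/gaussoid_reorient/gaussoid_relabel.
Qed.

Lemma biquadratic_inequalitiesP phi (e : monomial n * monomial n) :
  reflect (exists2 T, T \in edge_trinomials n & exists r r' : 'I_3,
             [/\ forall i : 'I_3, i != r ->
                   term_sign phi (tnth T i) != term_sign phi (tnth T r),
                 r' != r & e = ((tnth T r').2, (tnth T r).2)])
          (e \in biquadratic_inequalities phi).
Proof.
rewrite inE; apply: (iffP existsP) => [[T /andP[TP]]|[T TP [r [r' [rP ne ->]]]]].
  case/existsP => r /existsP[r' /and3P[/forallP rP ne /eqP eE]].
  exists T => //; exists r, r'; split=> // s' s'r.
  exact: implyP (rP s') s'r.
exists T; rewrite TP; apply/existsP; exists r; apply/existsP; exists r'.
by rewrite ne eqxx !andbT; apply/forallP => i; apply/implyP; apply: rP.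
Qed.

(** Only the position of the term of opposite sign matters, and a common sign
    change of the three terms preserves it. *)
Lemma biquadratic_inequalities_reorient L phi :
  biquadratic_inequalities (reorient L phi) = biquadratic_inequalities phi.
Proof.
apply/setP => e; apply/biquadratic_inequalitiesP/biquadratic_inequalitiesP;
  case=> T TP [r [r' [rP ne eE]]]; exists T => //; exists r, r'; split=> // i;
  move/rP; have [c cE] := term_sign_reorient L phi TP;
  by rewrite !cE (inj_eq (can_inj (addKb c))).
Qed.

Definition inequality_perm s (e : monomial n * monomial n) :
    monomial n * monomial n :=
  ((unknown_perm s e.1.1, unknown_perm s e.1.2),
   (unknown_perm s e.2.1, unknown_perm s e.2.2)).

Lemma inequality_permK s :
  cancel (inequality_perm s) (inequality_perm s^-1%g).
Proof. by move=> [[a b] [c d]]; rewrite /inequality_perm !unknown_permK. Qed.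

Lemma biquadratic_inequalities_relabel s phi e :
  (e \in biquadratic_inequalities (relabel s phi))
    = (inequality_perm s e \in biquadratic_inequalities phi).
Proof.
have half s' psi e' : e' \in biquadratic_inequalities (relabel s' psi) ->
    inequality_perm s' e' \in biquadratic_inequalities psi.
  case/biquadratic_inequalitiesP => T TP [r [r' [rP ne ->]]].
  apply/biquadratic_inequalitiesP; exists (map_tuple (term_perm s') T).
    exact: edge_trinomials_perm.
  exists r, r'; split=> //; last by rewrite !tnth_map.
  by move=> i /rP; rewrite !term_sign_relabel !tnth_map.
apply/idP/idP; first exact: half.
move=> eP; rewrite -[e](inequality_permK s); apply: half.
by rewrite relabel_comp mulVg relabel1.
Qed.

(** Reorientations keep the inequalities and relabellings rename the unknowns
    in them, so the weights are transported along the renaming. *)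
Lemma biquadratic_final_polynomial_symmetry (R : realType) phi psi w :
  psi \in symmetry_class phi -> biquadratic_final_polynomial (R := R) phi w ->
  exists w', biquadratic_final_polynomial (R := R) psi w'.
Proof.
case/symmetry_classP => L [s ->] [w_ge0 [e eP we_gt0] w_bal].
exists (w \o inequality_perm s).
rewrite /biquadratic_final_polynomial biquadratic_inequalities_reorient; split.
- by move=> e' e'P; apply: w_ge0; rewrite -biquadratic_inequalities_relabel.
- have sK := inequality_permK s^-1%g e; rewrite invgK in sK.
  exists (inequality_perm s^-1%g e); last by rewrite /= sK.
  by rewrite biquadratic_inequalities_relabel sK.
move=> u; rewrite -[RHS](w_bal (unknown_perm s u)).
rewrite [RHS](reindex_inj (can_inj (inequality_permK s))) /=.
apply: eq_big => [e'|e' _]; first by rewrite biquadratic_inequalities_relabel.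
by congr (_ * (_ - _)); rewrite /multiplicity /= !(inj_eq (can_inj (unknown_permK s))).
Qed.

End Symmetry.

(** * Minors and realizability *)

Lemma det_mx2 (V : comNzRingType) (F : nat -> nat -> V) :
  \det (\matrix_(r < 2, c < 2) F r c) = F 0 0 * F 1 1 - F 0 1 * F 1 0.
Proof.
rewrite (expand_det_row _ ord0) !big_ord_recl big_ord0 /cofactor !det_mx11 !mxE /=.
by rewrite /bump /=; ring.
Qed.

Lemma det_mx3 (V : comNzRingType) (F : nat -> nat -> V) :
  \det (\matrix_(r < 3, c < 3) F r c) =
  F 0 0 * (F 1 1 * F 2 2 - F 1 2 * F 2 1)
  - F 0 1 * (F 1 0 * F 2 2 - F 1 2 * F 2 0)
  + F 0 2 * (F 1 0 * F 2 1 - F 1 1 * F 2 0).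
Proof.
have minor2 (c : 'I_3) : \det (row' ord0 (col' c (\matrix_(r < 3, c < 3) F r c)))
    = F 1 (bump c 0) * F 2 (bump c 1) - F 1 (bump c 1) * F 2 (bump c 0).
  rewrite -(det_mx2 (fun r d => F r.+1 (bump c d))); congr (\det _).
  by apply/matrixP => r d; rewrite !mxE.
rewrite (expand_det_row _ ord0) !big_ord_recl big_ord0 /cofactor !minor2 !mxE /=.
by rewrite /bump /=; ring.
Qed.

Section Realizability.
Variables (R : realType) (n : nat).
Implicit Types (S : 'M[R]_n) (i j : 'I_n) (L K : {set 'I_n}).

Lemma positive_definite_congr S (A : 'M[R]_n) :
  A \in unitmx -> positive_definite S -> positive_definite (A *m S *m A^T).
Proof.
move=> Aunit [Ssym Spos]; split; first by rewrite !trmx_mul trmxK Ssym mulmxA.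
move=> u u0; have -> : u *m (A *m S *m A^T) *m u^T = (u *m A) *m S *m (u *m A)^T.
  by rewrite trmx_mul !mulmxA.
apply: Spos; apply: contraNneq u0 => uA0.
by rewrite -(mulmxK Aunit u) uA0 mul0mx.
Qed.

Lemma positive_definite1 : positive_definite (1%:M : 'M[R]_n).
Proof.
split=> [|u /rV0Pn[k uk]]; first exact: trmx1.
rewrite mulmx1 mxE (bigD1 k) //= mxE ltr_pwDl //.
  by rewrite -expr2 exprn_even_gt0.
by apply: sumr_ge0 => l _; rewrite mxE -expr2 sqr_ge0.
Qed.

Lemma positive_definite_diag S i : positive_definite S -> 0 < S i i.
Proof.
case=> _.
pose e : 'rV[R]_n := delta_mx 0 i; move=> /(_ e).
have -> : (e *m S *m e^T) 0 0 = S i i by rewrite trmx_delta -colE -(rowE i S) !mxE.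
by apply; apply/rV0Pn; exists i; rewrite mxE !eqxx oner_eq0.
Qed.

(** The dimension m is separate from the length of ks: the two agree only
    propositionally when ks is an enumeration of a set. *)
Definition minor m S i j (ks : seq 'I_n) : R :=
  \det (\matrix_(r < m.+1, c < m.+1)
          S (nth i (i :: ks) r) (nth j (j :: ks) c)).

(** The common index list may be reordered: rows and columns undergo the same
    permutation, whose sign enters the determinant twice. *)
Lemma minor_perm m S i j (s t : seq 'I_n) :
  size t = m -> perm_eq s t -> minor m S i j s = minor m S i j t.
Proof.
move=> /eqP szt; rewrite -[t]/(tval (Tuple szt)).
move: (Tuple szt) => {szt}t /tuple_permP[p ->].
pose q := lift_perm ord0 ord0 p.
rewrite /minor (_ : \matrix_(_, _) _ =
  row_perm q (col_perm q (\matrix_(r, c) S (nth i (i :: t) r) (nth j (j :: t) c)))).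
  rewrite row_permE col_permE !det_mulmx !det_perm odd_permV.
  by rewrite mulrC -mulrA -expr2 sqrr_sign mulr1.
have qE (k : 'I_n) (r : 'I_m.+1) :
    nth k (k :: t) (q r) = nth k (k :: [tuple tnth t (p x) | x < m]) r.
  case: (unliftP ord0 r) => [r'|] ->; last by rewrite lift_perm_id.
  by rewrite lift_perm_lift /= ?nth_mktuple (tnth_nth k) add0n.
by apply/matrixP => r c; rewrite !mxE !qE.
Qed.

Lemma almost_principal_minorE S i j K (ks : seq 'I_n) :
  uniq ks -> ks =i K -> almost_principal_minor S i j K = minor (size ks) S i j ks.
Proof.
move=> uks ksK.
have pE : perm_eq (enum K) ks.
  by apply: uniq_perm; rewrite ?enum_uniq // => x; rewrite mem_enum ksK.
by rewrite -(minor_perm _ _ _ erefl pE) -(perm_size pE) -cardE.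
Qed.

Lemma almost_principal_minor0 S i j :
  almost_principal_minor S i j set0 = S i j.
Proof.
rewrite (@almost_principal_minorE _ _ _ _ [::]) // => [|x]; last by rewrite inE.
by rewrite /minor det_mx11 mxE.
Qed.

Lemma almost_principal_minor1 S i j k :
  almost_principal_minor S i j [set k] = S i j * S k k - S i k * S k j.
Proof.
rewrite (@almost_principal_minorE _ _ _ _ [:: k]) // => [|x]; last by rewrite !inE.
exact: (det_mx2 (fun r c => S (nth i [:: i; k] r) (nth j [:: j; k] c))).
Qed.

(** Permuting the rows and columns of S alike realizes the relabelled map; the
    elements of s @: K come in another order, which is harmless by
    [minor_perm]. *)
Lemma realizable_relabel s (phi : sign_map n) :
  realizable R phi -> realizable R (relabel s phi).
Proof.
case=> S Spd Ssg; exists (\matrix_(a, b) S (s a) (s b)).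
  rewrite (_ : \matrix_(_, _) _ = perm_mx s *m S *m (perm_mx s)^T).
    by apply: positive_definite_congr => //; apply: unitmx_perm.
  by rewrite tr_perm_mx -row_permE -[s in RHS]invgK -col_permE invgK;
    apply/matrixP => a b; rewrite !mxE.
move=> i j K ij iK jK; rewrite unknown_sign_relabel unknown_perm_avar //.
rewrite -Ssg ?(inj_eq perm_inj) ?mem_imset //; try exact: perm_inj.
rewrite [in RHS](@almost_principal_minorE _ _ _ _ (map s (enum K))).
- rewrite size_map -cardE; congr (Num.sg (\det _)); apply/matrixP => r c.
  have e (k : 'I_n) (x : 'I_#|K|.+1) :
      nth (s k) (s k :: map s (enum K)) x = s (nth k (k :: enum K) x).
    by rewrite -map_cons (nth_map k) //= -cardE ltn_ord.
  by rewrite !mxE !e.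
- by rewrite map_inj_uniq ?enum_uniq //; apply: perm_inj.
by move=> x; apply/mapP/imsetP => -[y]; rewrite ?mem_enum => yK ->;
  exists y; rewrite ?mem_enum.
Qed.

(** Conjugating S by the diagonal sign matrix of L multiplies the minor
    a_{ij|K} by the signs of i and j; the signs of the elements of K occur once
    for the rows and once for the columns. *)
Lemma realizable_reorient L (phi : sign_map n) :
  realizable R phi -> realizable R (reorient L phi).
Proof.
case=> S Spd Ssg; pose d (a : 'I_n) : R := (-1) ^+ (a \in L).
pose D := diag_mx (\row_a d a).
have dd a : d a * d a = 1 by rewrite -expr2 sqrr_sign.
exists (D *m S *m D^T).
  apply: positive_definite_congr => //; rewrite unitmxE det_diag.
  rewrite unitfE; apply/prodf_neq0 => a _.
  by rewrite mxE signr_eq0.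
move=> i j K ij iK jK; rewrite unknown_sign_reorient // !signr_addb -Ssg //.
have eE k (x : 'I_#|K|) : nth k (enum K) x = enum_val x by rewrite (enum_val_nth k).
have -> : almost_principal_minor (D *m S *m D^T) i j K
    = d i * d j * almost_principal_minor S i j K.
  pose dr (k : 'I_n) := \row_(x < #|K|.+1) d (nth k (k :: enum K) x).
  rewrite /almost_principal_minor (_ : \matrix_(_, _) _ = diag_mx (dr i) *m
     (\matrix_(r, c) S (nth i (i :: enum K) r) (nth j (j :: enum K) c))
       *m diag_mx (dr j)); last first.
    apply/matrixP => r c.
    by rewrite tr_diag_mx !mul_mx_diag !mul_diag_mx !mxE.
  have det_dr k : \det (diag_mx (dr k)) = d k * \prod_(x < #|K|) d (enum_val x).
    rewrite det_diag big_ord_recl mxE; congr (_ * _); apply: eq_bigr => x _.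
    by rewrite mxE /= add0n eE.
  rewrite !det_mulmx !det_dr; set p := \prod_(_ < _) _.
  have pp : p * p = 1 by rewrite -big_split big1 // => x _; apply: dd.
  by rewrite mulrAC mulrACA pp mulr1.
rewrite !sgrM; by rewrite /d !sgrX !sgrN1.
Qed.

Lemma realizable_symmetry (phi psi : sign_map n) :
  psi \in symmetry_class phi -> realizable R phi -> realizable R psi.
Proof.
by case/symmetry_classP => L [s ->] r; apply/realizable_reorient/realizable_relabel.
Qed.

End Realizability.

(** * Sign maps on four elements as sign vectors *)

(** Labels are numbered from 1, as in the order of the 24 signs. *)
Definition label : Type := nat * nat * seq nat.
Definition elements (s : seq nat) : {set 'I_4} := [set x : 'I_4 | x.+1 \in s].
Definition label_var (l : label) : unknown 4 :=
  let: (a, b, s) := l in avar (element a) (element b) (elements s).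
Definition code (phi : sign_map 4) : seq bool :=
  [seq unknown_sign phi (label_var l) | l <- sign_order].

(** A label may list i, j and the elements of K in any order and with
    repetitions; its bits depend only on the unknown that it denotes. *)
Definition bits (s : seq nat) : seq bool := [seq x \in s | x <- iota 1 4].
Definition label_bits (l : label) : seq bool * seq bool :=
  let: (a, b, s) := l in (bits [:: a; b], bits s).
Definition slot (l : label) : nat := index (label_bits l) (map label_bits sign_order).
Arguments slot : simpl never.

Definition subsets : seq (seq nat) :=
  foldr (fun x ss => ss ++ map (cons x) ss) [:: [::]] (iota 1 4).
Definition proper_label (l : label) : bool :=
  let: (a, b, s) := l in
  [&& a \in iota 1 4, b \in iota 1 4, a != b, a \notin s & b \notin s].

Lemma ord4_succ (i : 'I_4) : i.+1 \in iota 1 4.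
Proof. by rewrite mem_iota /= add1n ltnS. Qed.

Lemma element_succ (i : 'I_4) : element i.+1 = i.
Proof. exact: inord_val. Qed.

Lemma succ_element a : a \in iota 1 4 -> (element a).+1 = a.
Proof. by case: a => [|a]; rewrite // mem_iota /= add1n ltnS => a4; rewrite inordK. Qed.

Lemma element_eq a b : a \in iota 1 4 -> b \in iota 1 4 ->
  (element a == element b) = (a == b).
Proof.
move=> a4 b4; apply/eqP/eqP => [ab|->//].
by rewrite -(succ_element a4) ab succ_element.
Qed.

Lemma mem_elements a s : a \in iota 1 4 -> (element a \in elements s) = (a \in s).
Proof. by move=> a4; rewrite inE succ_element. Qed.

Lemma elements_cons a s : a \in iota 1 4 ->
  element a |: elements s = elements (a :: s).
Proof.
move=> a4; apply/setP => x; rewrite !inE; congr (_ || _).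
by rewrite -[x in LHS]element_succ element_eq // ord4_succ.
Qed.

Lemma bits_elements s t : bits s = bits t -> elements s = elements t.
Proof.
by move/eq_in_map => st; apply/setP => x; rewrite !inE; apply/st/ord4_succ.
Qed.

Lemma subsets_filter (p : pred nat) : [seq a <- iota 1 4 | p a] \in subsets.
Proof. by rewrite /=; do 4![case: (p _)]. Qed.

Lemma elements_surj (K : {set 'I_4}) : exists2 s, s \in subsets & K = elements s.
Proof.
exists [seq a <- iota 1 4 | element a \in K]; first exact: subsets_filter.
by apply/setP => x; rewrite inE mem_filter element_succ ord4_succ andbT.
Qed.

Lemma sign_order_proper : {in sign_order, forall l, proper_label l}.
Proof. exact/allP. Qed.

(** A label has the bits of one whose list is among the 16 sorted ones, which
    leaves finitely many cases. *)
Lemma slot_lt l : proper_label l -> (slot l < size sign_order)%N.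
Proof.
case: l => [[a b] s] /and5P[a4 b4 ab aNs bNs].
pose t := [seq x <- iota 1 4 | x \in s].
have tE x : x \in iota 1 4 -> (x \in t) = (x \in s) by rewrite mem_filter andbC => ->.
have -> : slot (a, b, s) = slot (a, b, t).
  by congr (index (_, _) _); apply/eq_in_map => x /tE.
have : all (fun a => all (fun b => all (fun s =>
    proper_label (a, b, s) ==> (slot (a, b, s) < size sign_order)%N) subsets)
  (iota 1 4)) (iota 1 4) by vm_compute.
move=> /allP/(_ a a4)/allP/(_ b b4)/allP/(_ t (subsets_filter _))/implyP; apply.
by rewrite /proper_label a4 b4 ab !tE // aNs.
Qed.

Lemma sign_slot phi l : proper_label l ->
  unknown_sign phi (label_var l) = nth false (code phi) (slot l).
Proof.
move=> pl; have lt := slot_lt pl; pose l0 : label := (0, 0, [::])%N.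
rewrite (nth_map l0) //; congr (unknown_sign _ _).
have : label_bits (nth l0 sign_order (slot l)) = label_bits l.
  have lin : label_bits l \in map label_bits sign_order.
    by rewrite -index_mem size_map.
  by rewrite -[RHS](nth_index (label_bits l0) lin) (nth_map l0).
have pn := sign_order_proper (mem_nth l0 lt).
move: l (nth _ _ _) pl pn {lt} => [[a b] s] [[a' b'] s'].
move=> /and5P[a4 b4 _ _ _] /and5P[a4' b4' _ _ _] e.
have ab : bits [:: a'; b'] = bits [:: a; b] := congr1 fst e.
have ss : bits s' = bits s := congr1 snd e.
rewrite /label_var /avar (bits_elements ss).
suff -> : [set element a; element b] = [set element a'; element b'] by [].
have two c d : c \in iota 1 4 -> d \in iota 1 4 ->
    [set element c; element d] = elements [:: c; d].
  move=> c4 d4; rewrite -!elements_cons //; congr (_ |: _).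
  by apply/setP => x; rewrite !inE orbF.
by rewrite !two //; apply: esym; apply: bits_elements.
Qed.

Lemma size_code phi : size (code phi) = 24%N.
Proof. by rewrite size_map. Qed.

Lemma code_inj : injective code.
Proof.
move=> phi psi e; apply/ffunP => x.
have [i [j [K [ij iK jK _ vx]]]] := aidx_cases x.
have [s _ Ks] := elements_surj K.
have pl : proper_label (i.+1, j.+1, s).
  rewrite /proper_label !ord4_succ eqSS ij /=.
  by move: iK jK; rewrite Ks !inE => -> ->.
have := congr1 (fun c => nth false c (slot (i.+1, j.+1, s))) e.
by rewrite -!sign_slot //= !element_succ -Ks vx.
Qed.

(** The quadruple (p, q, r, t) stands for an edge trinomial whose terms have,
    in terms of the entries x of a sign vector, the signs
    x_p, - x_q and - x_r x_t. *)
Definition constraint : Type := nat * nat * nat * nat.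

Definition satisfies (x : seq bool) (c : constraint) : bool :=
  let: (p, q, r, t) := c in
  nth false x p (+) nth false x q
    ==> ~~ (nth false x p (+) nth false x r (+) nth false x t).

Definition constraints_at (a b c : nat) (s : seq nat) : seq constraint :=
  [:: (slot (b, c, s), slot (b, c, a :: s), slot (a, b, s), slot (a, c, s));
      (slot (a, c, s), slot (a, c, b :: s), slot (a, b, s), slot (b, c, a :: s));
      (slot (a, b, s), slot (a, b, c :: s), slot (a, c, b :: s), slot (b, c, a :: s))].

Definition proper_face (f : nat * nat * nat * seq nat) : bool :=
  let: (a, b, c, s) := f in
  all (mem (iota 1 4)) [:: a; b; c] && uniq [:: a, b, c & s].

Definition faces : seq (nat * nat * nat * seq nat) :=
  [seq f <- [seq (abc, s)
            | abc <- [seq (ab, c)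
                     | ab <- [seq (a, b) | a <- iota 1 4, b <- iota 1 4],
                       c <- iota 1 4],
              s <- subsets]
  | proper_face f].

Definition constraints : seq constraint :=
  flatten [seq let: (a, b, c, s) := f in constraints_at a b c s | f <- faces].

Lemma both_signs3 n (phi : sign_map n) A B u v w z :
  ([set term_sign phi t | t in [tuple (false, (pvar A, u)); (true, (pvar B, v));
     (true, (w, z))]] == [set false; true])
  = (unknown_sign phi u (+) unknown_sign phi v ==>
      ~~ (unknown_sign phi u (+) unknown_sign phi w (+) unknown_sign phi z)).
Proof.
rewrite both_signsE; pose t0 : term n := (false, (pvar A, u)).
apply/existsP/idP => [[r /existsP[r']]|].
  case: r r' => [[|[|[|//]]] ?] [[|[|[|//]]] ?]; rewrite !(tnth_nth t0) /term_sign /=;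
  by do ![case: (unknown_sign _ _)].
have [r0 r1 r2] : [/\ (0 < 3)%N, (1 < 3)%N & (2 < 3)%N] by [].
case: (boolP (unknown_sign phi u == unknown_sign phi v)) => uv c; exists (Ordinal r0);
 apply/existsP; [exists (Ordinal r1)|exists (Ordinal r2)];
 rewrite !(tnth_nth t0) /term_sign /=; move: uv c;
 by do ![case: (unknown_sign _ _)].
Qed.

Lemma proper_faceP a b c s : proper_face (a, b, c, s) ->
  [/\ [/\ a \in iota 1 4, b \in iota 1 4 & c \in iota 1 4],
      [/\ a != b, a != c & b != c] & [/\ a \notin s, b \notin s & c \notin s]].
Proof.
rewrite /proper_face /= !andbT !inE !negb_or => /andP[/and3P[a4 b4 c4]].
by case/andP => /and3P[ab ac aNs] /and3P[/andP[bc bNs] cNs _].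
Qed.

Lemma constraints_atE phi a b c s : proper_face (a, b, c, s) ->
  all (satisfies (code phi)) (constraints_at a b c s) =
  all (fun T : trinomial 4 => [set term_sign phi t | t in T] == [set false; true])
    (trinomials_at (element a) (element b) (element c) (elements s)).
Proof.
move=> /proper_faceP[[a4 b4 c4] [ab ac bc] [aNs bNs cNs]].
have [ba ca cb] : [/\ b != a, c != a & c != b] by split; rewrite eq_sym.
rewrite /trinomials_at !elements_cons //= !both_signs3.
have sg d e t : proper_label (d, e, t) ->
    unknown_sign phi (avar (element d) (element e) (elements t))
      = nth false (code phi) (slot (d, e, t)).
  exact: (sign_slot phi).
by rewrite !sg // /proper_label ?a4 ?b4 ?c4 ?inE ?negb_or
  ?ab ?ac ?bc ?ba ?ca ?cb ?aNs ?bNs ?cNs.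
Qed.

Lemma gaussoid_codeE phi :
  uniform_oriented_gaussoid phi = all (satisfies (code phi)) constraints.
Proof.
apply/forall_inP/allP => [gphi c|sat T].
  case/flatten_mapP => -[[[a b] c'] s]; rewrite mem_filter => /andP[pf _].
  move: c; apply/allP; rewrite constraints_atE //; apply/allP => T TP.
  apply/gphi/edge_trinomialsP.
  exists (element a), (element b), (element c'), (elements s).
  have [[a4 b4 c4] [ab ac bc] [aNs bNs cNs]] := proper_faceP pf.
  by split; [rewrite /= !inE negb_or !element_eq // ab ac bc
    | rewrite !mem_elements | exact: TP].
case/edge_trinomialsP => i [j [k [L [uq [iL jL kL] TP]]]].
have [s s_sub Ls] := elements_surj L.
have pf : proper_face (i.+1, j.+1, k.+1, s).
  rewrite /proper_face /= !ord4_succ /=; move: uq iL jL kL.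
  rewrite Ls /= !inE !negb_or !eqSS !andbT => /andP[/andP[-> ->] ->] -> -> -> /=.
  have : all uniq subsets by vm_compute.
  by move/allP; apply.
have : all (satisfies (code phi)) (constraints_at i.+1 j.+1 k.+1 s).
  apply/allP => c cP; apply: sat; apply/flatten_mapP.
  exists (i.+1, j.+1, k.+1, s) => //.
  rewrite mem_filter pf andTb; apply: (allpairs_f pair) s_sub.
  do 2?apply: (allpairs_f pair); exact: ord4_succ.
by rewrite constraints_atE // !element_succ -Ls => /allP; apply.
Qed.

(** * Symmetries acting on sign vectors *)

Definition flips (s : seq nat) : seq bool :=
  [seq let: (a, b, _) := l in (a \in s) (+) (b \in s) | l <- sign_order].

Definition xor_code (x y : seq bool) : seq bool :=
  [seq p.1 (+) p.2 | p <- zip x y].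

Lemma code_reorient s phi :
  code (reorient (elements s) phi) = xor_code (flips s) (code phi).
Proof.
rewrite /xor_code /flips /code zip_map -map_comp; apply/eq_in_map => -[[a b] K].
move=> /sign_order_proper/and5P[a4 b4 ab aNK bNK] /=.
by rewrite unknown_sign_reorient ?element_eq // !mem_elements.
Qed.

Definition perm_word (p : 'S_4) : seq nat := [seq (p (element a)).+1 | a <- iota 1 4].

(** Entry number [l] of the relabelled vector is the old entry at the slot of
    the permuted label. *)
Definition perm_slots (w : seq nat) : seq nat :=
  [seq let: (a, b, K) := l in
       slot (nth 0 w a.-1, nth 0 w b.-1, [seq nth 0 w k.-1 | k <- K])%N
  | l <- sign_order].

Lemma nth_perm_word p a :
  a \in iota 1 4 -> nth 0%N (perm_word p) a.-1 = (p (element a)).+1.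
Proof.
case: a => [|a]; rewrite // mem_iota /= add1n ltnS => a4.
by rewrite (nth_map 0%N) ?size_iota // nth_iota.
Qed.

Lemma imset_elements (p : 'S_4) s : all (mem (iota 1 4)) s ->
  p @: elements s = elements [seq nth 0%N (perm_word p) a.-1 | a <- s].
Proof.
move/allP => s4; apply/setP => x; rewrite inE.
apply/imsetP/mapP => [[y]|[a a_s]].
  rewrite inE => ys ->; exists y.+1 => //.
  by rewrite nth_perm_word ?ord4_succ // element_succ.
have a4 := s4 a a_s; rewrite nth_perm_word // => -[xE].
by exists (element a); [rewrite mem_elements | apply: val_inj].
Qed.

Lemma code_relabel (p : 'S_4) phi :
  code (relabel p phi) = [seq nth false (code phi) k | k <- perm_slots (perm_word p)].
Proof.
rewrite -map_comp; apply/eq_in_map => -[[a b] K] lK /=.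
have /and5P[a4 b4 ab aNK bNK] := sign_order_proper lK.
have K4 : all (mem (iota 1 4)) K.
  have : all (fun l => all (mem (iota 1 4)) l.2) sign_order by [].
  by move/allP/(_ _ lK).
rewrite unknown_sign_relabel unknown_perm_avar ?element_eq ?mem_elements //.
rewrite imset_elements // !nth_perm_word // -sign_slot; last first.
  rewrite /proper_label !ord4_succ eqSS /= (inj_eq val_inj).
  rewrite (inj_eq perm_inj) element_eq // ab /=.
  have notin c : c \in iota 1 4 -> c \notin K ->
      (p (element c)).+1 \notin [seq nth 0%N (perm_word p) k.-1 | k <- K].
    move=> c4; apply: contra => /mapP[k kK].
    have k4 := allP K4 k kK; rewrite nth_perm_word // => -[] /val_inj/perm_inj/eqP.
    by rewrite element_eq // => /eqP->.
  by rewrite !notin.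
by rewrite /label_var !element_succ.
Qed.

Lemma perm_wordP w :
  reflect (exists p, w = perm_word p) (w \in permutations (iota 1 4)).
Proof.
have pE (p : 'S_4) :
    [tuple tnth (iota_tuple 4 1) (p i) | i < 4] = perm_word p :> seq nat.
  rewrite /= /perm_word.
  have -> : iota 1 4 = map succn (map val (enum 'I_4)) by rewrite val_enum_ord.
  rewrite -!map_comp; apply: eq_map => i /=.
  by rewrite element_succ (tnth_nth 0%N) nth_iota.
rewrite mem_permutations.
apply: (iffP (tuple_permP (t := iota_tuple 4 1))) => [[p ->]|[p ->]]; exists p.
  exact: pE.
by rewrite pE.
Qed.

(** * Enumeration of the least sign vectors *)

(** The lexicographic order on [seqlexi bool], in a form that evaluates
    quickly and stops at the first difference. *)
Fixpoint le_code (x y : seq bool) : bool :=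
  match x, y with
  | a :: x', b :: y' => if a (+) b then b else le_code x' y'
  | [::], _ => true
  | _, [::] => false
  end.

Lemma le_codeE (x y : seq bool) : le_code x y = ((x : seqlexi bool) <= y)%O.
Proof.
by elim: x y => [|a x IH] [|b y] //=; rewrite IH lexi_cons; case: a b => [] [].
Qed.

Lemma le_code_take m x y : le_code x y -> le_code (take m x) (take m y).
Proof.
by elim: x y m => [|a x IH] [|b y] [|m] //=; case: (_ (+) _) => //; apply: IH.
Qed.

Definition all_flips : seq (seq bool) := map flips subsets.
Definition all_slots : seq (seq nat) := map perm_slots (permutations (iota 1 4)).

(** Relabelling first and reorienting afterwards reaches the whole class, by
    [symmetry_classP]. *)
Definition least_code (x : seq bool) : bool :=
  all (fun ks => let y := [seq nth false x k | k <- ks] in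
         all (fun m => le_code x (xor_code m y)) all_flips) all_slots.

Lemma least_codeP phi :
  reflect (forall psi, psi \in symmetry_class phi -> le_code (code phi) (code psi))
          (least_code (code phi)).
Proof.
apply: (iffP allP) => [least psi /symmetry_classP[L [p ->]]|least ks].
  have [s s_sub ->] := elements_surj L; rewrite code_reorient code_relabel.
  have pw : perm_word p \in permutations (iota 1 4) by apply/perm_wordP; exists p.
  have /allP := least _ (map_f perm_slots pw); apply; exact: map_f.
case/mapP => w /perm_wordP[p ->] ->; apply/allP => _ /mapP[s s_sub ->].
rewrite -code_relabel -code_reorient; apply: least.
by apply/symmetry_classP; exists (elements s), p.
Qed.

(** The constraints tested here are those whose last entry is the new one; the
    others have been tested on shorter prefixes. *)
Definition extend_prefixes (m : nat) (xs : seq (seq bool)) : seq (seq bool) :=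
  let cs := [seq c <- constraints |
               let: (p, q, r, t) := c in maxn (maxn p q) (maxn r t) == m] in
  [seq x <- [seq rcons x b | x <- xs, b <- [:: false; true]]
  | all (satisfies x) cs && all (fun f => le_code x (xor_code f x)) all_flips].

Fixpoint gaussoid_prefixes (m : nat) : seq (seq bool) :=
  if m is m'.+1 then extend_prefixes m' (gaussoid_prefixes m') else [:: [::]].

Lemma take_xor_code m x y : take m (xor_code x y) = xor_code x (take m y).
Proof.
rewrite /xor_code -map_take; congr map.
by elim: x y m => [|a x IH] [|b y] [|m] //=; rewrite ?IH ?take0 //; case: x {IH}.
Qed.

(** The vector of a least gaussoid is not larger than any of its
    reorientations.  This passes to prefixes, because a reorientation flips
    entries without moving them. *)
Lemma gaussoid_prefixes_complete phi m :
  uniform_oriented_gaussoid phi -> least_code (code phi) -> (m <= 24)%N ->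
  take m (code phi) \in gaussoid_prefixes m.
Proof.
rewrite gaussoid_codeE => /allP sat /least_codeP least.
elim: m => [|m IH] m24; first by rewrite take0.
rewrite -[gaussoid_prefixes _]/(extend_prefixes m (gaussoid_prefixes m)).
rewrite mem_filter; apply/andP; split; last first.
  rewrite (take_nth false) ?size_code //; apply: allpairs_f (IH (ltnW m24)) _.
  by case: (nth _ _ _).
apply/andP; split; apply/allP.
  move=> [[[p q] r] t]; rewrite mem_filter => /andP[/eqP mE cP].
  have := sat _ cP; rewrite /satisfies !nth_take // ltnS -mE ?leq_max ?leqnn ?orbT //.
move=> _ /mapP[s s_sub ->]; rewrite -take_xor_code; apply: le_code_take.
rewrite -code_reorient; apply: least; apply/symmetry_classP.
by exists (elements s), 1%g; rewrite relabel1.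
Qed.

Definition signs_of (v : string) : seq bool :=
  [seq Ascii.eqb c "-"%char | c <- list_ascii_of_string v].

Definition representative_codes : seq (seq bool) := map signs_of sign_vectors.

(** There are 672 surviving vectors of length 24; each is compared with its
    images under the 24 relabellings followed by the 16 reorientations. *)
Lemma least_gaussoid_codes :
  perm_eq [seq x <- gaussoid_prefixes 24 | least_code x] representative_codes.
Proof. by vm_compute. Qed.

Lemma representatives_satisfy :
  all (fun x => all (satisfies x) constraints) representative_codes.
Proof. by vm_compute. Qed.

Lemma uniq_representative_codes : uniq representative_codes.
Proof. by vm_compute. Qed.

Lemma label_setsE l : l \in sign_order ->
  let: (a, b, K) := l in
  label_sets l = ([set element a; element b], elements K).
Proof.
case: l => [[a b] K] lK; congr pair; apply/setP => x; rewrite !inE.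
have /allP K4 : all (mem (iota 1 4)) K.
  have : all (fun l => all (mem (iota 1 4)) l.2) sign_order by [].
  by move/allP/(_ _ lK).
apply/mapP/idP => [[a' a'K ->]|xK]; first by rewrite (succ_element (K4 _ a'K)).
by exists x.+1; rewrite ?element_succ.
Qed.

(** The bits of a label can be read off its sets, and the 24 bit patterns are
    distinct by computation. *)
Lemma uniq_label_sets : uniq (map label_sets sign_order).
Proof.
pose F (AB : {set 'I_4} * {set 'I_4}) :=
  ([seq element a \in AB.1 | a <- iota 1 4], [seq element a \in AB.2 | a <- iota 1 4]).
apply: (@map_uniq _ _ F); rewrite -map_comp.
have /eq_in_map -> : {in sign_order, F \o label_sets =1 label_bits}; last by vm_compute.
move=> [[a b] K] lK; have /and5P[a4 b4 _ _ _] := sign_order_proper lK.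
rewrite -[LHS]/(F (label_sets (a, b, K))) (label_setsE lK).
congr pair; apply/eq_in_map => c c4 /=.
  by rewrite !inE !element_eq.
exact: mem_elements.
Qed.

Lemma code_sign_map_of v :
  size (signs_of v) = 24%N -> code (sign_map_of v) = signs_of v.
Proof.
move=> sz; pose l0 : label := (0, 0, [::])%N.
apply: (@eq_from_nth _ false); rewrite size_code ?sz // => k k24.
rewrite (nth_map l0) //; set l := nth l0 _ _.
have lP : l \in sign_order by rewrite mem_nth.
case lE : l (sign_order_proper lP) (label_setsE lP) => [[a b] K].
move=> /and5P[a4 b4 ab aNK bNK] ls.
rewrite /label_var;
have [||| x vx ->] := @insub_aidxP _ (element a) (element b) (elements K);
  rewrite ?element_eq ?mem_elements //.
rewrite /= ffunE vx -ls -lE /l -(nth_map _ (label_sets l0)) // index_uniq ?size_map //.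
exact: uniq_label_sets.
Qed.

Lemma code_representatives : map code representatives = representative_codes.
Proof.
rewrite /representatives /representative_codes.
have : all (fun v => size (signs_of v) == 24%N) sign_vectors by vm_compute.
by elim: sign_vectors => //= v vs IH /andP[/eqP v24 /IH ->]; rewrite code_sign_map_of.
Qed.

(** * Realizations by integer triangular matrices *)

Section TriangularFactors.
Variable R : realType.

(** Minors are evaluated on binary integers, where large products are cheap,
    and then mapped to the reals. *)
Definition real_of_Z (z : Z) : R := (int_of_Z z)%:~R.
HB.instance Definition _ := GRing.RMorphism.copy real_of_Z (intr \o int_of_Z).

Lemma sgr_real_of_Z z (b : bool) : (if b then Z.ltb z Z0 else Z.ltb Z0 z) ->
  Num.sg (real_of_Z z) = (-1) ^+ b.
Proof.
rewrite /real_of_Z; case: b; case: z => //= p _.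
  by rewrite ltr0_sg // ltrz0.
by rewrite gtr0_sg // ltr0z ltz_nat; apply/ssrnat.ltP/Pos2Nat.is_pos.
Qed.

(** Rows are lists; missing entries are zero, which is how lower triangular
    matrices are written below. *)
Definition entry (A : seq (seq Z)) (i j : nat) : Z := nth Z0 (nth [::] A i) j.

Definition gram (A : seq (seq Z)) (a b : nat) : Z :=
  foldr (fun k z => entry A a.-1 k * entry A b.-1 k + z) 0 (iota 0 4).

(** The determinant with rows a :: s and columns b :: s, for s of length at most
    two: K has at most two elements when n = 4. *)
Definition small_minor (V : comNzRingType) (f : nat -> nat -> V) (a b : nat)
    (s : seq nat) : V :=
  match s with
  | [::] => f a b
  | [:: c] => f a b * f c c - f a c * f c b
  | [:: c, d & _] =>
      f a b * (f c c * f d d - f c d * f d c)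
      - f a c * (f c b * f d d - f c d * f d b)
      + f a d * (f c b * f d c - f c c * f d b)
  end.

Lemma minor_small (S : 'M[R]_4) a b s : (size s <= 2)%N ->
  minor (size s) S (element a) (element b) (map element s)
    = small_minor (fun a b => S (element a) (element b)) a b s.
Proof.
pose F r c := S (nth (element a) (element a :: map element s) r)
                (nth (element b) (element b :: map element s) c).
rewrite -[minor _ _ _ _ _]/(\det (\matrix_(r < (size s).+1, c < (size s).+1) F r c)).
rewrite {}/F; case: s => [|c [|d [|//]]] _.
- by rewrite det_mx11 mxE.
- exact: (det_mx2 (fun r d => S (nth _ [:: _; _] r) (nth _ [:: _; _] d))).
- exact: (det_mx3 (fun r e => S (nth _ [:: _; _; _] r) (nth _ [:: _; _; _] e))).
Qed.

Lemma small_minor_real (f : nat -> nat -> Z) a b s :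
  small_minor (fun a b => real_of_Z (f a b)) a b s = real_of_Z (small_minor f a b s).
Proof.
by case: s => [|c [|d s]] //=; rewrite !(rmorphD, rmorphN, rmorphM).
Qed.

Lemma eq_small_minor (V : comNzRingType) (f g : nat -> nat -> V) a b s :
  {in a :: b :: s &, f =2 g} -> small_minor f a b s = small_minor g a b s.
Proof. by case: s => [|c [|d s]] fg /=; rewrite !fg ?inE ?eqxx ?orbT. Qed.

Definition labels : seq label :=
  [seq l <- [seq (ab, s) | ab <- [seq (a, b) | a <- iota 1 4, b <- iota 1 4],
                           s <- subsets] | proper_label l].

Definition realizes (A : seq (seq Z)) (x : seq bool) : bool :=
  all (fun l => let: (a, b, s) := l in
         let z := small_minor (gram A) a b s in
         (size s <= 2)%N && if nth false x (slot l) then Z.ltb z Z0 else Z.ltb Z0 z)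
    labels
  && all (fun i => (entry A i i != 0)
                   && all (fun j => (i < j)%N ==> (entry A i j == 0)) (iota 0 4))
       (iota 0 4).

(** With L the matrix of A, the matrix L L^T is congruent to the identity, hence
    positive definite, since the determinant of L is the product of its
    nonzero diagonal. *)
Lemma realizable_factor A phi : realizes A (code phi) -> realizable R phi.
Proof.
case/andP => signs triangular.
pose L : 'M[R]_4 := \matrix_(i, j) real_of_Z (entry A i j).
have trig (i j : 'I_4) : (entry A i i != 0) && ((i < j)%N ==> (entry A i j == 0)).
  have in4 (k : 'I_4) : (k : nat) \in iota 0 4 by rewrite mem_iota /=.
  by have /andP[-> /allP/(_ _ (in4 j))] := allP triangular _ (in4 i).
have SE (i j : 'I_4) : (L *m 1%:M *m L^T) i j = real_of_Z (gram A i.+1 j.+1).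
  rewrite mulmx1 mxE !big_ord_recl big_ord0 !mxE /= !rmorphD !rmorphM.
  by rewrite rmorph0.
exists (L *m 1%:M *m L^T).
  apply: positive_definite_congr; last exact: positive_definite1.
  rewrite unitmxE det_trig; last first.
    apply/is_trig_mxP => i j ij; rewrite mxE.
    by have /andP[_ /implyP/(_ ij)/eqP->] := trig i j; rewrite rmorph0.
  rewrite unitfE; apply/prodf_neq0 => i _; rewrite mxE.
  have /andP[ii _] := trig i i; rewrite intr_eq0.
  by rewrite -(inj_eq (can_inj int_of_ZK)) in ii.
move=> i j K ij iK jK; have [s s_sub Ks] := elements_surj K.
have pl : proper_label (i.+1, j.+1, s).
  rewrite /proper_label !ord4_succ eqSS ij /=.
  by move: iK jK; rewrite Ks !inE => -> ->.
have lP : (i.+1, j.+1, s) \in labels.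
  rewrite mem_filter pl andTb; apply: (allpairs_f pair) s_sub.
  by apply: (allpairs_f pair); apply: ord4_succ.
have /andP[s2 sgn] := allP signs _ lP.
have [us s4] : uniq s /\ {subset s <= iota 1 4}.
  have : all (fun s => uniq s && all (mem (iota 1 4)) s) subsets by [].
  by move=> /allP/(_ _ s_sub)/andP[-> /allP].
rewrite (@almost_principal_minorE _ _ _ _ _ _ (map element s)); first last.
- move=> x; rewrite Ks inE; apply/mapP/idP => [[a a_s ->]|xs].
    by rewrite succ_element // s4.
  by exists x.+1; rewrite ?element_succ.
- rewrite map_inj_in_uniq // => a b a_s b_s /eqP.
  by rewrite element_eq ?s4 // => /eqP.
rewrite size_map -[i]element_succ -[j]element_succ minor_small //.
have SEe a b : a \in iota 1 4 -> b \in iota 1 4 ->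
    (L *m 1%:M *m L^T) (element a) (element b) = real_of_Z (gram A a b).
  by move=> a4 b4; rewrite SE !succ_element.
rewrite (@eq_small_minor _ _ (fun a b => real_of_Z (gram A a b))); last first.
  by move=> a b; rewrite !in_cons => /or3P[/eqP->|/eqP->|/s4 a4]
    /or3P[/eqP->|/eqP->|/s4 b4]; apply: SEe; rewrite ?ord4_succ.
rewrite small_minor_real (sgr_real_of_Z sgn) -(sign_slot phi pl).
by rewrite /label_var !element_succ Ks.
Qed.

Local Open Scope Z_scope.
(** Factors for the representatives 1, ..., 35, 37, ..., 46, in this order. *)
Definition triangular_factors : seq (seq (seq Z)) := [::
  [:: [:: 1]; [:: 1; 2]; [:: 1; 1; 2]; [:: 1; 1; 1; 2]];
  [:: [:: 1]; [:: 1; 2]; [:: 1; -1; 2]; [:: 1; -1; -2; 1]];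
  [:: [:: 1]; [:: 3; 2]; [:: 2; -1; 3]; [:: 1; -2; -3; 2]];
  [:: [:: 5]; [:: 6; 5]; [:: 6; 2; 3]; [:: 7; 4; -1; 7]];
  [:: [:: 1]; [:: 1; 1]; [:: 3; -1; 2]; [:: 1; -2; 1; 1]];
  [:: [:: 1]; [:: 1; 2]; [:: 3; -1; 1]; [:: 1; -1; 2; 1]];
  [:: [:: 1]; [:: 2; 3]; [:: 3; 1; 3]; [:: 2; -1; -1; 1]];
  [:: [:: 2]; [:: 2; 1]; [:: 3; 1; 1]; [:: 2; -1; -2; 3]];
  [:: [:: 1]; [:: 1; 2]; [:: 1; 1; 3]; [:: 3; -1; -1; 1]];
  [:: [:: 3]; [:: 3; 4]; [:: 4; 4; 3]; [:: 4; -1; -1; 4]];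
  [:: [:: 2]; [:: 2; 1]; [:: 3; -1; 3]; [:: 1; -1; 1; 1]];
  [:: [:: 1]; [:: 1; 1]; [:: 2; 1; 2]; [:: 1; -2; -2; 1]];
  [:: [:: 1]; [:: 1; 2]; [:: 3; -1; 2]; [:: 1; 1; 2; 1]];
  [:: [:: 2]; [:: 1; 1]; [:: 3; -1; 1]; [:: 1; -2; 1; 2]];
  [:: [:: 2]; [:: 1; 1]; [:: 3; -2; 1]; [:: 2; 1; 1; 1]];
  [:: [:: 1]; [:: 1; 2]; [:: 2; 1; 2]; [:: 2; 2; 2; 1]];
  [:: [:: 1]; [:: 2; 1]; [:: 2; -1; 2]; [:: 2; -1; -2; 1]];
  [:: [:: 1]; [:: 2; 1]; [:: 2; -1; 2]; [:: 1; -1; -1; 1]];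
  [:: [:: 1]; [:: 1; 1]; [:: 2; 1; 2]; [:: 1; -2; -1; 1]];
  [:: [:: 1]; [:: 2; 1]; [:: 2; -1; 2]; [:: 1; -1; 1; 2]];
  [:: [:: 1]; [:: 3; 2]; [:: 2; 1; 3]; [:: 1; -1; -1; 2]];
  [:: [:: 1]; [:: 1; 1]; [:: 2; -1; 2]; [:: 2; 1; 1; 1]];
  [:: [:: 1]; [:: 3; 2]; [:: 2; 1; 1]; [:: 1; -1; -2; 2]];
  [:: [:: 1]; [:: 3; 1]; [:: 3; -1; 1]; [:: 1; -2; -1; 1]];
  [:: [:: 1]; [:: 2; 1]; [:: 2; -2; 1]; [:: 3; 1; 1; 3]];
  [:: [:: 1]; [:: 1; 1]; [:: 3; 1; 2]; [:: 2; -1; -1; 3]];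
  [:: [:: 4]; [:: 3; 1]; [:: 5; -1; 2]; [:: 4; 1; 5; 3]];
  [:: [:: 2]; [:: 2; 3]; [:: 3; 1; 3]; [:: 3; 3; 2; 3]];
  [:: [:: 1]; [:: 1; 1]; [:: 2; 1; 2]; [:: 2; 1; -1; 2]];
  [:: [:: 1]; [:: 1; 2]; [:: 2; -2; 1]; [:: 1; -2; -1; 1]];
  [:: [:: 1]; [:: 1; 2]; [:: 1; 1; 3]; [:: 1; 1; -1; 3]];
  [:: [:: 1]; [:: 1; 3]; [:: 1; 1; 3]; [:: 1; -3; -2; 1]];
  [:: [:: 2]; [:: 3; 1]; [:: 2; -1; 2]; [:: 1; -2; 3; 2]];
  [:: [:: 2]; [:: 1; 1]; [:: 2; -1; 2]; [:: 1; 2; 3; 1]];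
  [:: [:: 1]; [:: 2; 1]; [:: 1; -1; 2]; [:: 1; -1; -2; 1]];
  [:: [:: 2]; [:: 2; 3]; [:: 2; -1; 3]; [:: 1; -2; -3; 2]];
  [:: [:: 1]; [:: 1; 1]; [:: 2; 1; 2]; [:: 2; -1; -1; 2]];
  [:: [:: 1]; [:: 2; 1]; [:: 2; -1; 2]; [:: 2; -2; 2; 1]];
  [:: [:: 2]; [:: 1; 1]; [:: 3; -2; 2]; [:: 2; -1; 2; 1]];
  [:: [:: 1]; [:: 2; 3]; [:: 2; 1; 3]; [:: 1; 1; 1; 1]];
  [:: [:: 1]; [:: 1; 3]; [:: 1; 2; 3]; [:: 1; 2; -1; 3]];
  [:: [:: 1]; [:: 2; 1]; [:: 1; -1; 1]; [:: 1; -1; 2; 1]];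
  [:: [:: 1]; [:: 1; 1]; [:: 2; 1; 3]; [:: 3; -1; -1; 1]];
  [:: [:: 1]; [:: 1; 1]; [:: 2; -1; 2]; [:: 1; -2; 1; 2]];
  [:: [:: 2]; [:: 1; 1]; [:: 2; -1; 1]; [:: 1; -3; -1; 1]]].
Local Close Scope Z_scope.

End TriangularFactors.

Lemma factors_realize :
  all2 realizes triangular_factors
    (rem (nth [::] representative_codes 35) representative_codes).
Proof. by vm_compute. Qed.

(** * The class without a realization *)

Section Class36.
Variable R : realType.
Implicit Type phi : sign_map 4.

(** When all a_{xy} are positive, the trinomial
    p_i a_{jk} - p_{} a_{jk|i} - a_{ij} a_{ik} compares p_i a_{jk} with
    a_{ij} a_{ik}, and the sign of a_{jk|i} tells which one is larger. *)
Definition vertex_inequality phi (i j k : 'I_4) : monomial 4 * monomial 4 :=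
  let pa := (pvar [set i], avar j k set0) in
  let aa := (avar i j set0, avar i k set0) in
  if unknown_sign phi (avar j k [set i]) then (pa, aa) else (aa, pa).

Lemma vertex_inequality_in phi i j k :
  uniq [:: i; j; k] ->
  (forall x y, x != y -> unknown_sign phi (avar x y set0) = false) ->
  vertex_inequality phi i j k \in biquadratic_inequalities phi.
Proof.
move=> uq pos.
pose T : trinomial 4 := [tuple (false, (pvar (i |: set0), avar j k set0));
  (true, (pvar set0, avar j k (i |: set0))); (true, (avar i j set0, avar i k set0))].
apply/biquadratic_inequalitiesP; exists T.
  by apply/edge_trinomialsP; exists i, j, k, set0; rewrite !inE eqxx.
move: uq; rewrite /= !inE negb_or andbT => /andP[/andP[ij ik] jk].
have [r0 r2] : (0 < 3)%N /\ (2 < 3)%N by [].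
rewrite /vertex_inequality; case: ifP => sgn;
  [exists (Ordinal r2), (Ordinal r0) | exists (Ordinal r0), (Ordinal r2)];
  rewrite /T !(tnth_nth (false, (pvar set0, pvar set0))) /= setU0; split=> //;
  move=> [[|[|[|//]]] ?] //= _; rewrite !(tnth_nth (false, (pvar set0, pvar set0))) /=;
  by rewrite /term_sign /= ?sgn ?pos.
Qed.

Lemma sum_count_mem (T : finType) (A : {set T}) (s : seq T) (f : T -> R) :
  {subset s <= A} ->
  \sum_(e in A) (count_mem e s)%:R * f e = \sum_(e <- s) f e.
Proof.
elim: s => [|x s IH] sA; first by rewrite big_nil big1 // => e _; rewrite mul0r.
rewrite big_cons -IH => [|e e_s]; last by apply: sA; rewrite inE e_s orbT.
under eq_bigr => e _ do rewrite /= natrD mulrDl.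
rewrite big_split /=; congr (_ + _).
rewrite (bigD1 x) ?sA ?mem_head //= eqxx mul1r big1 ?addr0 // => e /andP[_ ex].
by rewrite eq_sym (negbTE ex) mul0r.
Qed.

(** The four inequalities displayed at the top, in the same order. *)
Definition certificate phi : seq (monomial 4 * monomial 4) :=
  [:: vertex_inequality phi (element 1) (element 3) (element 4);
      vertex_inequality phi (element 4) (element 1) (element 2);
      vertex_inequality phi (element 4) (element 2) (element 3);
      vertex_inequality phi (element 1) (element 2) (element 3)].

Lemma certificate_balanced phi :
  unknown_sign phi (avar (element 3) (element 4) [set element 1]) ->
  ~~ unknown_sign phi (avar (element 1) (element 2) [set element 4]) ->
  unknown_sign phi (avar (element 2) (element 3) [set element 4]) ->
  ~~ unknown_sign phi (avar (element 2) (element 3) [set element 1]) ->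
  forall u, \sum_(e <- certificate phi)
     (multiplicity R u e.2 - multiplicity R u e.1) = 0.
Proof.
move=> s1 /negbTE s2 s3 /negbTE s4 u.
rewrite !big_cons big_nil /vertex_inequality s1 s2 s3 s4 /multiplicity /=.
rewrite (avarC (element 4) (element 1)) (avarC (element 4) (element 2)).
rewrite (avarC (element 4) (element 3)) !natrD.
by ring.
Qed.

Lemma code_representative k : (k < 46)%N ->
  code (representative k.+1) = nth [::] representative_codes k.
Proof.
move=> k46; by rewrite -code_representatives (nth_map [ffun=> false]).
Qed.

Definition sign36 (l : label) : bool :=
  nth false (nth [::] representative_codes 35) (slot l).

Lemma sign_representative36 a b s : proper_label (a, b, s) ->
  unknown_sign (representative 36) (avar (element a) (element b) (elements s))
    = sign36 (a, b, s).
Proof.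
move=> pl; rewrite -[avar _ _ _]/(label_var (a, b, s)) (sign_slot _ pl).
by rewrite (@code_representative 35).
Qed.

Lemma elements0 : elements [::] = set0.
Proof. by apply/setP => x; rewrite !inE. Qed.

Lemma elements1 a : a \in iota 1 4 -> elements [:: a] = [set element a].
Proof. by move=> a4; rewrite -elements_cons // elements0 setU0. Qed.

Lemma sign36_pos (i j : 'I_4) : i != j ->
  unknown_sign (representative 36) (avar i j set0) = false.
Proof.
move=> ij; have pl : proper_label (i.+1, j.+1, [::]).
  by rewrite /proper_label !ord4_succ eqSS ij.
rewrite -[i]element_succ -[j]element_succ -elements0 sign_representative36 //.
have : all (fun a => all (fun b => proper_label (a, b, [::]) ==> ~~ sign36 (a, b, [::]))
  (iota 1 4)) (iota 1 4) by vm_compute.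
move=> /allP/(_ _ (ord4_succ i))/allP/(_ _ (ord4_succ j))/implyP/(_ pl).
exact: negbTE.
Qed.

Lemma signs36 :
  let neg i j k :=
    unknown_sign (representative 36)
      (avar (element i) (element j) [set element k]) in
  [/\ neg 3 4 1, ~~ neg 1 2 4, neg 2 3 4 & ~~ neg 2 3 1]%N.
Proof. by rewrite /= -!elements1 // !sign_representative36 //; split; vm_compute. Qed.

Lemma representative36_final_polynomial :
  exists w, biquadratic_final_polynomial (R := R) (representative 36) w.
Proof.
have [s1 s2 s3 s4] := signs36.
exists (fun e => (count_mem e (certificate (representative 36)))%:R).
have certI : {subset certificate (representative 36)
    <= biquadratic_inequalities (representative 36)}.
  move=> e; rewrite /certificate !in_cons in_nil orbF.
  by case/or4P => /eqP->; apply: vertex_inequality_in sign36_pos;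
    rewrite /= !inE !element_eq.
split=> [e _||u]; first exact: ler0n.
  exists (vertex_inequality (representative 36) (element 1) (element 3) (element 4)).
    by apply: certI; rewrite mem_head.
  by rewrite ltr0n -has_count has_pred1 mem_head.
by rewrite sum_count_mem // certificate_balanced.
Qed.

(** The four inequalities of the certificate are signs of minors of size two;
    their product has the same monomial on both sides. *)
Lemma representative36_not_realizable : ~ realizable R (representative 36).
Proof.
case=> S Spd Ssg; have Ssym (i j : 'I_4) : S i j = S j i.
  by case: Spd => St _; rewrite -[in LHS]St mxE.
have a_gt0 (i j : 'I_4) : i != j -> 0 < S i j.
  move=> ij; have := Ssg i j set0 ij.
  rewrite !inE almost_principal_minor0 sign36_pos //.
  by move=> /(_ isT isT) e; rewrite -sgr_cp0 e.
have [s1 s2 s3 s4] := signs36.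
have ne a b : [&& a \in iota 1 4, b \in iota 1 4 & a != b] -> element a != element b.
  by case/and3P => a4 b4; rewrite element_eq.
have minor_lt0 (i j k : 'I_4) : i != j -> i != k -> j != k ->
    unknown_sign (representative 36) (avar i j [set k]) ->
    S i j * S k k < S i k * S j k.
  move=> ij ik jk sgn; have := Ssg i j [set k] ij.
  rewrite !inE ik jk sgn almost_principal_minor1 (Ssym k) => /(_ isT isT) e.
  by rewrite -subr_lt0 -sgr_cp0 e.
have minor_gt0 (i j k : 'I_4) : i != j -> i != k -> j != k ->
    ~~ unknown_sign (representative 36) (avar i j [set k]) ->
    S i k * S j k < S i j * S k k.
  move=> ij ik jk /negbTE sgn; have := Ssg i j [set k] ij.
  rewrite !inE ik jk sgn almost_principal_minor1 (Ssym k) => /(_ isT isT) e.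
  by rewrite -subr_gt0 -sgr_cp0 e.
have sw (i j : 'I_4) : i != j -> j != i by rewrite eq_sym.
have h1 := minor_lt0 _ _ _ (ne 3%N 4%N isT)
  (sw _ _ (ne 1%N 3%N isT)) (sw _ _ (ne 1%N 4%N isT)) s1.
have h2 := minor_gt0 _ _ _ (ne 1%N 2%N isT) (ne 1%N 4%N isT) (ne 2%N 4%N isT) s2.
have h3 := minor_lt0 _ _ _ (ne 2%N 3%N isT) (ne 2%N 4%N isT) (ne 3%N 4%N isT) s3.
have h4 := minor_gt0 _ _ _ (ne 2%N 3%N isT)
  (sw _ _ (ne 1%N 2%N isT)) (sw _ _ (ne 1%N 3%N isT)) s4.
have S_ge0 i j : 0 <= S i j.
  have [->|ij] := eqVneq i j; last exact/ltW/a_gt0.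
  exact/ltW/positive_definite_diag.
have M_ge0 i j k l : 0 <= S i j * S k l by rewrite mulr_ge0.
have := ltr_pM (mulr_ge0 (M_ge0 _ _ _ _) (M_ge0 _ _ _ _))
  (mulr_ge0 (M_ge0 _ _ _ _) (M_ge0 _ _ _ _))
  (ltr_pM (M_ge0 _ _ _ _) (M_ge0 _ _ _ _) h1 h2)
  (ltr_pM (M_ge0 _ _ _ _) (M_ge0 _ _ _ _) h3 h4).
rewrite (Ssym (element 3) (element 1)) (Ssym (element 4) (element 1)).
rewrite (Ssym (element 2) (element 1)).
by case/lt_eqF/eqP; ring.
Qed.

End Class36.

(** * The classification *)

Lemma representative_least phi : phi \in representatives ->
  uniform_oriented_gaussoid phi /\
  forall psi, psi \in symmetry_class phi -> le_code (code phi) (code psi).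
Proof.
move=> phiP; have : code phi \in representative_codes.
  by rewrite -code_representatives map_f.
move=> cP; split.
  by rewrite gaussoid_codeE; apply: (allP representatives_satisfy).
by apply/least_codeP; move: cP;
  rewrite -(perm_mem least_gaussoid_codes) mem_filter => /andP[].
Qed.

Lemma gaussoid_representative phi : uniform_oriented_gaussoid phi ->
  exists2 r, r \in representatives & phi \in symmetry_class r.
Proof.
move=> gphi.
have [psi psiP least] : exists2 psi, psi \in symmetry_class phi &
    forall chi, chi \in symmetry_class phi -> le_code (code psi) (code chi).
  have phiP : phi \in symmetry_class phi by apply: orbit_refl.
  case: (arg_minP (fun psi : sign_map 4 => code psi : seqlexi bool) phiP).
  move=> psi psiP least.
  by exists psi => // chi /least; rewrite le_codeE.
exists psi; last by rewrite symmetry_class_sym.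
have gpsi := gaussoid_symmetry psiP gphi.
have lpsi : least_code (code psi).
  apply/least_codeP => chi chiP; apply: least.
  by move/orbit_eqP: psiP => e; rewrite /symmetry_class -e.
have := gaussoid_prefixes_complete gpsi lpsi (leqnn 24).
have -> : take 24 (code psi) = code psi by apply: take_oversize; rewrite size_code.
move=> cP.
have : code psi \in representative_codes.
  by rewrite -(perm_mem least_gaussoid_codes) mem_filter lpsi.
by rewrite -code_representatives => /mapP[r rP /code_inj->].
Qed.

(** Two representatives in one class are each not larger than the other. *)
Lemma uniq_symmetry_classes : uniq [seq symmetry_class phi | phi <- representatives].
Proof.
rewrite map_inj_in_uniq; last first.
  move=> r r' /representative_least[_ least] /representative_least[_ least'] e.
  apply: code_inj; apply: (@le_anti _ (seqlexi bool)).
  rewrite -!le_codeE; apply/andP; split.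
    by apply: least; rewrite e; apply: orbit_refl.
  by apply: least'; rewrite -e; apply: orbit_refl.
apply: (@map_uniq _ _ code); rewrite code_representatives.
exact: uniq_representative_codes.
Qed.

Lemma realizable_representative (R : realType) r :
  r \in representatives -> r != representative 36 -> realizable R r.
Proof.
move=> rP r36; have /(nthP [::])[k k_lt kE] :
    code r \in rem (nth [::] representative_codes 35) representative_codes.
  rewrite mem_rem_uniq ?uniq_representative_codes // inE -(@code_representative 35) //.
  by rewrite (inj_eq code_inj) -code_representatives map_f // andbT.
have := factors_realize; rewrite all2E => /andP[/eqP sz /allP fP].
apply: (@realizable_factor _ (nth [::] triangular_factors k)); rewrite -kE.
have := fP (nth ([::], [::]) (zip triangular_factors
  (rem (nth [::] representative_codes 35) representative_codes)) k).
rewrite nth_zip //; apply.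
by rewrite -nth_zip // mem_nth // size_zip sz minnn.
Qed.

Local Close Scope ring_scope.

Theorem theorem8p1 (R : realType) :
  [/\ #|gaussoid_classes 4| = 46,
      all (@uniform_oriented_gaussoid 4) representatives
        /\ perm_eq [seq symmetry_class phi | phi <- representatives]
                   (enum (gaussoid_classes 4)),
      (forall phi : sign_map 4, uniform_oriented_gaussoid phi ->
         (realizable R phi <-> phi \notin symmetry_class (representative 36)))
    & (forall phi : sign_map 4, phi \in symmetry_class (representative 36) ->
         exists w : monomial 4 * monomial 4 -> R,
           biquadratic_final_polynomial phi w)].
Proof.
have perm_classes : perm_eq [seq symmetry_class phi | phi <- representatives]
    (enum (gaussoid_classes 4)).
  apply: uniq_perm; rewrite ?enum_uniq ?uniq_symmetry_classes // => C.
  rewrite mem_enum; apply/mapP/imsetP => [[r rP ->]|[phi]].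
    by exists r => //; rewrite inE; have [] := representative_least rP.
  rewrite inE => /gaussoid_representative[r rP phiP] ->; exists r => //.
  exact/orbit_eqP.
split=> [|||phi phiP].
- by rewrite cardE -(perm_size perm_classes) size_map.
- by split=> //; apply/allP => r /representative_least[].
- move=> phi gphi; split=> [real|nin].
    apply/negP => phiP; apply: (@representative36_not_realizable R).
    by apply: realizable_symmetry real; rewrite symmetry_class_sym.
  have [r rP phiP] := gaussoid_representative gphi.
  apply: (realizable_symmetry phiP); apply: (realizable_representative _ rP).
  by apply: contraNneq nin => <-.
have [w wP] := representative36_final_polynomial R.
exact: biquadratic_final_polynomial_symmetry phiP wP.
Qed.
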